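(* Let $L \in \mathbb{R}^{n\times n}$ be the combinatorial directed Laplacian of a directed weighted graph on $n$ vertices, and assume $L$ is diagonalizable, $L=V\Lambda V^{-1}$, with right eigenvectors $v_1,\dots,v_n$ (the columns of the invertible matrix $V\in\mathbb{C}^{n\times n}$). Let $\Omega\subset\{1,\dots,n\}$ be an index set of size $K\ge 1$, let $V_\Omega := [v_k]_{k\in\Omega}\in\mathbb{C}^{n\times K}$, and let $B_\Omega$ be the column span of $V_\Omega$. Let $M\subseteq\{1,\dots,n\}$ be a set of $m$ vertices with restriction operator $P_M\in\{0,1\}^{m\times n}$, let $B:=P_MV_\Omega$, assume $\operatorname{rank}(B)=K$, and put $\gamma(M,\Omega):=\sigma_{\min}(B)>0$. Let $x\in B_\Omega$, let $y=P_Mx+\eta$ with noise $\eta\in\mathbb{C}^m$, and let $\hat{x}$ be the least-squares reconstruction $\hat{x}=V_\Omega\hat{c}$ with $\hat{c}=B^\dagger y$. Then $$\|\hat{x}-x\|_2 \;\le\; \|V_\Omega\|_2\,\frac{\|\eta\|_2}{\gamma(M,\Omega)}.$$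
   Context: Directed Laplacian: for a directed weighted graph on vertex set $\{1,\dots,n\}$ with real edge weights $w(i,j)$, the adjacency matrix $A\in\mathbb{R}^{n\times n}$ has $A_{ij}=w(i,j)$ if $(i,j)$ is an edge (oriented $i\to j$) and $A_{ij}=0$ otherwise; the out-degrees are $d_i^{\mathrm{out}}=\sum_{j=1}^n A_{ij}$, $D_{\mathrm{out}}=\operatorname{diag}(d_1^{\mathrm{out}},\dots,d_n^{\mathrm{out}})$, and $L := D_{\mathrm{out}}-A$. The eigenvectors $v_k$ satisfy $Lv_k=\lambda_kv_k$ and need not be orthogonal or normalized; $\Lambda=\operatorname{diag}(\lambda_1,\dots,\lambda_n)$. The set $\Omega$ is thought of as indexing modes with small $|\lambda_k|$, and signals in $B_\Omega$ are called $\Omega$-bandlimited. The operator $P_M$ extracts from a vector in $\mathbb{C}^n$ the entries indexed by $M$. $B^\dagger$ is the Moore–Penrose pseudoinverse of $B$, and $\sigma_{\min}(B)$ is the smallest of the $K$ singular values of the full-column-rank $m\times K$ matrix $B$. For vectors $\|\cdot\|_2$ is the Euclidean norm; for matrices it is the spectral (operator) norm. In this statement $\hat{x}$ denotes the reconstructed signal. *)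

(* Defs.v *)
From mathcomp Require Import all_boot all_order all_algebra.
From mathcomp Require Import sesquilinear spectral.
From mathcomp Require Import classical_sets reals.
From mathcomp Require Import complex.

Set Implicit Arguments.
Unset Strict Implicit.
Unset Printing Implicit Defensive.

Import Order.TTheory GRing.Theory Num.Theory.
Local Open Scope classical_set_scope.
Local Open Scope ring_scope.
Local Open Scope sesquilinear_scope.

Definition adjacency (R : realType) n (e : rel 'I_n) (w : 'I_n -> 'I_n -> R) :
    'M[R]_n :=
  \matrix_(i, j) if e i j then w i j else 0.

Definition out_degree (R : realType) n (A : 'M[R]_n) : 'rV[R]_n :=
  \row_i \sum_j A i j.

Definition laplacian (R : realType) n (e : rel 'I_n) (w : 'I_n -> 'I_n -> R) :
    'M[R]_n :=
  diag_mx (out_degree (adjacency e w)) - adjacency e w.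

Definition complexify (R : realType) m n (A : 'M[R]_(m, n)) : 'M[R[i]]_(m, n) :=
  map_mx (real_complex R) A.

(* Columns (resp. coordinates) indexed by a set are listed in the increasing
   order of [enum]. *)
Definition col_restrict (C : Type) m n (V : 'M[C]_(m, n)) (Omega : {set 'I_n}) :
    'M[C]_(m, #|Omega|) :=
  colsub enum_val V.

Definition restriction (C : pzSemiRingType) n (M : {set 'I_n}) :
    'M[C]_(#|M|, n) :=
  \matrix_(i, j) (enum_val i == j)%:R.

Definition colspan (F : fieldType) m n (A : 'M[F]_(m, n)) : {vspace 'cV[F]_m} :=
  <<[seq col j A | j : 'I_n]>>%VS.

Definition l2norm (R : realType) n (x : 'cV[R[i]]_n) : R :=
  Num.sqrt (\sum_i (complex.Re (x i 0) ^+ 2 + complex.Im (x i 0) ^+ 2)).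

Definition spectral_norm (R : realType) m n (A : 'M[R[i]]_(m, n)) : R :=
  sup [set l2norm (A *m x) | x in [set x : 'cV[R[i]]_n | l2norm x <= 1]].

(* The n singular values of an m x n matrix are the nonnegative square roots of
   the eigenvalues of A^* A; when m < n this includes n - m zeros. *)
Definition singular_values (R : realType) m n (A : 'M[R[i]]_(m, n)) : set R :=
  [set s | 0 <= s /\ eigenvalue (A ^t* *m A) (real_complex R (s ^+ 2))].

(* The set is finite, and nonempty as soon as 0 < n, so [inf] is a minimum. *)
Definition sigma_min (R : realType) m n (A : 'M[R[i]]_(m, n)) : R :=
  inf (singular_values A).

Section MoorePenrose.
Variable C : numClosedFieldType.

Definition penrose m n (A : 'M[C]_(m, n)) (X : 'M[C]_(n, m)) : bool :=
  [&& A *m X *m A == A, X *m A *m X == X,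
      (A *m X) ^t* == A *m X & (X *m A) ^t* == X *m A].

Lemma ctmxM m n p (A : 'M[C]_(m, n)) (B : 'M[C]_(n, p)) :
  (A *m B) ^t* = B ^t* *m A ^t*.
Proof. by rewrite trmx_mul map_mxM. Qed.

Lemma ctmxV n (A : 'M[C]_n) : (invmx A) ^t* = invmx (A ^t*).
Proof. by rewrite trmx_inv map_invmx. Qed.

Lemma gram_unitmx m n (A : 'M[C]_(m, n)) : row_free A -> A *m A ^t* \in unitmx.
Proof.
move=> fA; rewrite -row_free_unit -kermx_eq0.
apply/eqP/row_matrixP => i; rewrite row0.
set v := row i _.
have v0 : v *m (A *m A ^t*) = 0.
  by rewrite /v -row_mul mulmx_ker row0.
have : dotmx (v *m A) (v *m A) = 0.
  by rewrite dotmxE ctmxM -!mulmxA (mulmxA A) (mulmxA v) v0 mul0mx mxE.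
by move/eqP; rewrite dnorm_eq0 mulmx_free_eq0 // => /eqP.
Qed.

Lemma penrose_mul m r n (E : 'M[C]_(m, r)) (F : 'M[C]_(r, n)) :
  row_full E -> row_free F -> exists X, penrose (E *m F) X.
Proof.
move=> fullE freeF.
have uF : F *m F ^t* \in unitmx by apply: gram_unitmx.
have uE : E ^t* *m E \in unitmx.
  have /gram_unitmx : row_free (E ^t*).
    by rewrite /row_free mxrank_map mxrank_tr.
  by rewrite trmxCK.
pose G := invmx (F *m F ^t*); pose H := invmx (E ^t* *m E).
pose X := F ^t* *m G *m H *m E ^t*.
have AX : E *m F *m X = E *m H *m E ^t*.
  by rewrite /X !mulmxA -(mulmxA E F) -(mulmxA E _ G) mulmxV // mulmx1.
have XA : X *m (E *m F) = F ^t* *m G *m F.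
  rewrite /X !mulmxA -(mulmxA _ (E ^t*)) -(mulmxA _ H) mulVmx //.
  by rewrite mulmx1.
exists X; apply/and4P; split; apply/eqP.
- rewrite AX !mulmxA -(mulmxA _ (E ^t*)) -(mulmxA _ H) mulVmx //.
  by rewrite mulmx1.
- rewrite XA /X !mulmxA -(mulmxA _ F) -(mulmxA _ _ G) mulmxV //.
  by rewrite mulmx1.
- by rewrite AX !ctmxM ctmxV ctmxM !trmxCK mulmxA.
- by rewrite XA !ctmxM ctmxV ctmxM !trmxCK mulmxA.
Qed.

Lemma penrose_exists m n (A : 'M[C]_(m, n)) : exists X, penrose A X.
Proof.
have := penrose_mul (col_base_full A) (row_base_free A).
by rewrite mulmx_base.
Qed.

Definition pinv m n (A : 'M[C]_(m, n)) : 'M[C]_(n, m) :=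
  xchoose (penrose_exists A).

Lemma pinvP m n (A : 'M[C]_(m, n)) : penrose A (pinv A).
Proof. exact: xchooseP. Qed.

Lemma penrose_unique m n (A : 'M[C]_(m, n)) X Y :
  penrose A X -> penrose A Y -> X = Y.
Proof.
move=> /and4P[/eqP x1 /eqP x2 /eqP x3 /eqP x4].
move=> /and4P[/eqP y1 /eqP y2 /eqP y3 /eqP y4].
have e1 : A *m X = A *m Y.
  by rewrite -{1}y1 -mulmxA -y3 -x3 -ctmxM mulmxA x1 y3.
have e2 : X *m A = Y *m A.
  by rewrite -{1}y1 -mulmxA mulmxA -y4 -x4 -ctmxM -!mulmxA (mulmxA A X) x1 y4.
by rewrite -x2 e2 -mulmxA e1 mulmxA y2.
Qed.

End MoorePenrose.

(* Main.v *)
Require Import Defs.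
From mathcomp Require Import all_boot all_order all_algebra.
From mathcomp Require Import sesquilinear spectral.
From mathcomp Require Import classical_sets reals.
From mathcomp Require Import complex.
Set Implicit Arguments.
Unset Strict Implicit.
Unset Printing Implicit Defensive.
Import Order.TTheory GRing.Theory Num.Theory.
Local Open Scope ring_scope.

(** Since B has full column rank, B^+ B = 1, so writing x = V_Omega c the error
    is V_Omega z with z = B^+ eta.  Then |V_Omega z| <= |V_Omega| |z|, and
    gamma |z| <= |B z| <= |eta| because B z = B B^+ eta is the orthogonal
    projection of eta onto the range of B.  Diagonalizing A^* A in a unitary
    basis as diag (s_i ^ 2) gives |A z|^2 = \sum_i s_i ^ 2 |(U z)_i|^2, which
    yields both the finiteness of the operator norm and the lower bound by the
    smallest singular value. *)

(** Full column rank lets [A] be cancelled on the left of [A *m (pinv A *m A) = A]. The cancellation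
    is carried out on transposes, where it becomes injectivity of multiplication by a [row_free]
    matrix. *)
Lemma pinv_mulmx_full (C : numClosedFieldType) m n (A : 'M[C]_(m, n)) :
  \rank A = n -> pinv A *m A = 1%:M.
Proof.
move=> rA; have fA : row_free (A^T) by rewrite /row_free mxrank_tr rA.
have /and4P[/eqP AXA _ _ _] := pinvP A.
apply: trmx_inj; apply: (row_free_inj fA).
by rewrite -!trmx_mul mulmxA AXA mulmx1.
Qed.

Section EuclideanNorm.
Local Open Scope sesquilinear_scope.
Local Open Scope complex_scope.
Variable R : realType.

(** * The Euclidean norm on complex columns *)

Lemma l2norm_ge0 n (x : 'cV[R[i]]_n) : 0 <= l2norm x.
Proof. exact: sqrtr_ge0. Qed.

Lemma l2norm_sqr n (x : 'cV[R[i]]_n) :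
  l2norm x ^+ 2 = \sum_i (complex.Re (x i 0) ^+ 2 + complex.Im (x i 0) ^+ 2).
Proof. by rewrite sqr_sqrtr // sumr_ge0 // => i _; rewrite addr_ge0 ?sqr_ge0. Qed.

Lemma l2norm_sqr_normE n (x : 'cV[R[i]]_n) :
  (l2norm x ^+ 2)%:C = \sum_i `|x i 0| ^+ 2.
Proof.
by rewrite l2norm_sqr rmorph_sum; apply: eq_bigr => i _; exact: add_Re2_Im2.
Qed.

Lemma l2norm_sqrE n (x : 'cV[R[i]]_n) :
  (l2norm x ^+ 2)%:C = (x ^t* *m x) 0 0.
Proof.
rewrite l2norm_sqr_normE mxE; apply: eq_bigr => i _.
by rewrite !mxE normCK mulrC.
Qed.

Lemma l2norm_eq0 n (x : 'cV[R[i]]_n) : (l2norm x == 0) = (x == 0).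
Proof.
apply/eqP/eqP => [x0|->]; last first.
  by rewrite /l2norm big1 ?sqrtr0 // => i _; rewrite mxE /= expr0n addr0.
have /esym/eqP := l2norm_sqr_normE x.
rewrite x0 expr0n psumr_eq0 => [/allP h|i _]; last exact: exprn_ge0.
apply/colP => i; rewrite mxE; apply/eqP.
by move: (h i (mem_index_enum i)); rewrite expf_eq0 /= normr_eq0.
Qed.

Lemma l2normZ n (a : R) (x : 'cV[R[i]]_n) :
  l2norm (a%:C *: x) = `|a| * l2norm x.
Proof.
rewrite -(sqrtr_sqr a) -sqrtrM ?sqr_ge0 // mulr_sumr.
congr Num.sqrt; apply: eq_bigr => i _; rewrite mxE.
by case: (x i 0) => b c /=; rewrite !mul0r subr0 addr0 !exprMn mulrDr.
Qed.

Lemma l2norm_unitary n (U : 'M[R[i]]_n) (x : 'cV[R[i]]_n) :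
  U \is unitarymx -> l2norm (U *m x) = l2norm x.
Proof.
move=> Uu; apply/eqP; rewrite -(@eqrXn2 _ 2) ?l2norm_ge0 //.
apply/eqP/complexI; rewrite !l2norm_sqrE ctmxM -mulmxA (mulmxA _ U).
by rewrite -invmx_unitary // mulVmx ?mul1mx // unitarymx_unit.
Qed.

(** * Unitary diagonalization of the Gram matrix *)

(** The Gram matrix is Hermitian, hence normal, so the spectral theorem applies; the columns of
    [U ^t*] are right singular vectors of [A]. *)
Lemma gram_spectral m n (A : 'M[R[i]]_(m, n)) :
  exists (U : 'M[R[i]]_n) (s : 'I_n -> R),
    [/\ U \is unitarymx, forall i, 0 <= s i &
        A ^t* *m A = U ^t* *m diag_mx (\row_i (s i ^+ 2)%:C) *m U].
Proof.
have nG : A ^t* *m A \is normalmx.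
  by apply/normalmxP; rewrite ctmxM trmxCK.
have Uu := spectral_unitarymx (A ^t* *m A).
move/orthomx_spectralP: nG.
set U := spectralmx _ in Uu *; set d := spectral_diag _ => GE.
(* The i-th eigenvalue is the Rayleigh quotient of the i-th eigenvector, hence
   a square. *)
exists U, (fun i => l2norm (A *m col i (U ^t*))); split=> //.
  by move=> i; exact: l2norm_ge0.
rewrite [LHS]GE invmx_unitary //; congr (_ *m diag_mx _ *m _).
apply/rowP => i; rewrite mxE l2norm_sqrE ctmxM -mulmxA (mulmxA _ A) GE.
rewrite invmx_unitary // colE ctmxM trmxCK !mulmxA.
rewrite mulmxtVK // -(mulmxA _ U) (unitarymxP Uu) mulmx1.
rewrite -!mulmxA mul_diag_mx mxE (bigD1 i) //= big1 ?addr0 => [|j ji].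
  by rewrite !mxE !eqxx conjC1 mul1r mulr1.
by rewrite !mxE (negbTE ji) conjC0 mul0r.
Qed.

Lemma l2norm_mulmx_sqr m n (A : 'M[R[i]]_(m, n)) U (s : 'I_n -> R) x :
  A ^t* *m A = U ^t* *m diag_mx (\row_i (s i ^+ 2)%:C) *m U ->
  l2norm (A *m x) ^+ 2 =
    \sum_i s i ^+ 2 * (complex.Re ((U *m x) i 0) ^+ 2 +
                       complex.Im ((U *m x) i 0) ^+ 2).
Proof.
move=> GE; apply: complexI; rewrite l2norm_sqrE ctmxM -mulmxA (mulmxA _ A) GE.
rewrite !mulmxA -ctmxM -!mulmxA mul_diag_mx mxE rmorph_sum.
apply: eq_bigr => i _; rewrite rmorphM /= [in RHS]add_Re2_Im2 normCK !mxE.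
by rewrite mulrCA [_^* * _]mulrC.
Qed.

(** * The operator norm *)

Lemma spectral_norm_has_ub m n (A : 'M[R[i]]_(m, n)) :
  has_ubound [set l2norm (A *m x) | x in [set x : 'cV[R[i]]_n | l2norm x <= 1]].
Proof.
have [U [s [Uu s0 GE]]] := gram_spectral A.
(* This bound is the Frobenius norm of [A]: the [s i ^+ 2] sum to the trace of the Gram matrix. It
   suffices because every coordinate of [U *m x] has modulus at most 1. *)
exists (Num.sqrt (\sum_i s i ^+ 2)) => _ [x /= x1 <-].
rewrite -(ger0_norm (l2norm_ge0 _)) -sqrtr_sqr ler_wsqrtr //.
rewrite (l2norm_mulmx_sqr _ GE) ler_sum // => i _.
rewrite ler_piMr ?sqr_ge0 //.
have : l2norm (U *m x) ^+ 2 <= 1 by rewrite l2norm_unitary // exprn_ile1 ?l2norm_ge0.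
apply: le_trans; rewrite l2norm_sqr (bigD1 i) //= lerDl sumr_ge0 // => j _.
by rewrite addr_ge0 ?sqr_ge0.
Qed.

Lemma spectral_norm_ge0 m n (A : 'M[R[i]]_(m, n)) : 0 <= spectral_norm A.
Proof.
apply: le_trans (l2norm_ge0 (A *m 0)) _.
apply: ub_le_sup (spectral_norm_has_ub A) _ _; exists 0 => //=.
by have /eqP -> : l2norm (0 : 'cV[R[i]]_n) == 0; rewrite ?l2norm_eq0 ?ler01.
Qed.

Lemma l2norm_mulmx_le m n (A : 'M[R[i]]_(m, n)) x :
  l2norm (A *m x) <= spectral_norm A * l2norm x.
Proof.
have [->|x0] := eqVneq x 0.
  have n0 k : l2norm (0 : 'cV[R[i]]_k) = 0 by apply/eqP; rewrite l2norm_eq0.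
  by rewrite mulmx0 !n0 mulr0.
(* By homogeneity it is enough to test [x] divided by its norm, which lies in the unit ball. *)
have nx : 0 < l2norm x by rewrite lt_neqAle eq_sym l2norm_eq0 x0 l2norm_ge0.
rewrite -ler_pdivrMr // mulrC -[(l2norm x)^-1]gtr0_norm ?invr_gt0 //.
rewrite -l2normZ scalemxAr; apply: ub_le_sup (spectral_norm_has_ub A) _ _.
by eexists; last reflexivity; rewrite /= l2normZ gtr0_norm ?invr_gt0 // mulVf ?gt_eqF.
Qed.

(** * Singular values and the smallest one *)

(** Multiplication by [U ^t*] turns a row eigenvector of the Gram matrix into one of the diagonal
    matrix; a nonzero coordinate [i] forces [t ^+ 2 = s i ^+ 2], and nonnegativity removes the
    squares. Conversely, row [i] of [U] is an eigenvector. *)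
Lemma singular_values_gram m n (A : 'M[R[i]]_(m, n)) U (s : 'I_n -> R) t :
  U \is unitarymx -> (forall i, 0 <= s i) ->
  A ^t* *m A = U ^t* *m diag_mx (\row_i (s i ^+ 2)%:C) *m U ->
  singular_values A t <-> exists i, t = s i.
Proof.
move=> Uu s0 GE; split=> [[t0 /eigenvalueP[v vG v0]]|[i ->]].
  pose u := v *m U ^t*.
  have uD : u *m diag_mx (\row_i (s i ^+ 2)%:C) = (t ^+ 2)%:C *: u.
    by rewrite /u scalemxAl -vG GE !mulmxA mulmxtVK.
  have /rV0Pn[i ui] : u != 0.
    apply: contraNneq v0 => u0.
    by rewrite -(mulmxKtV v Uu) // -/u u0 mul0mx.
  exists i; apply/eqP; rewrite -(@eqrXn2 _ 2) //; apply/eqP/complexI.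
  apply: (mulIf ui); move/rowP/(_ i): uD.
  by rewrite mul_mx_diag !mxE mulrC => <-.
split=> //; apply/eigenvalueP; exists (row i U).
  rewrite GE !mulmxA -row_mul (unitarymxP Uu) row1 -rowE.
  by rewrite row_diag_mx mxE -scalemxAl -rowE.
(* A zero row of [U] would contradict the diagonal entry 1 of [U *m U ^t*]. *)
apply/negP => /eqP Ui0; have /matrixP/(_ i i) := unitarymxP Uu.
rewrite !mxE eqxx big1 => [/esym/eqP|j _]; first by rewrite oner_eq0.
by move/rowP/(_ j): Ui0; rewrite !mxE => ->; rewrite mul0r.
Qed.

Lemma sigma_min_ge0 m n (A : 'M[R[i]]_(m, n)) : 0 <= sigma_min A.
Proof.
(* The set is empty exactly when [n = 0]; [inf] then takes its default value 0. *)
have [S0|/set0P ne] := eqVneq (singular_values A) set0.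
  by rewrite /sigma_min S0 inf0.
by apply: lb_le_inf ne _ => t [].
Qed.

Lemma sigma_min_l2norm m n (A : 'M[R[i]]_(m, n)) x :
  sigma_min A * l2norm x <= l2norm (A *m x).
Proof.
have [U [s [Uu s0 GE]]] := gram_spectral A.
rewrite -(@ler_pXn2r _ 2) ?nnegrE ?mulr_ge0 ?sigma_min_ge0 ?l2norm_ge0 //.
rewrite exprMn (l2norm_mulmx_sqr _ GE) -(l2norm_unitary _ Uu) l2norm_sqr.
rewrite mulr_sumr ler_sum // => i _; rewrite ler_wpM2r ?addr_ge0 ?sqr_ge0 //.
rewrite ler_pXn2r ?nnegrE ?sigma_min_ge0 //; apply: ge_inf.
  by exists 0 => t [].
by apply/(singular_values_gram _ Uu s0 GE); exists i.
Qed.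

(** Full column rank makes the Gram matrix invertible, so 0 is not a singular value. *)
Lemma sigma_min_gt0 m n (A : 'M[R[i]]_(m, n)) :
  (0 < n)%N -> \rank A = n -> 0 < sigma_min A.
Proof.
move=> n0 rA; have [U [s [Uu s0 GE]]] := gram_spectral A.
have s_gt0 i : 0 < s i.
  rewrite lt_neqAle s0 andbT eq_sym; apply/negP => /eqP si0.
  have Gu : A ^t* *m A \in unitmx.
    have /gram_unitmx : row_free (A ^t*) by rewrite /row_free mxrank_map mxrank_tr rA.
    by rewrite trmxCK.
  have : singular_values A 0.
    by apply/(singular_values_gram _ Uu s0 GE); exists i.
  case=> _ /eigenvalueP[v]; rewrite expr0n scale0r => vG.
  by rewrite -(mulmxK Gu v) vG mul0mx eqxx.
pose i0 := Ordinal n0.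
(* An infimum of positive numbers could still vanish; the least of the finitely many [s i] is a
   positive lower bound. *)
have [j _ sj] := @Order.TotalTheory.arg_minP _ _ _ i0 xpredT s isT.
apply: lt_le_trans (s_gt0 j) _; apply: lb_le_inf.
  by exists (s i0); apply/(singular_values_gram _ Uu s0 GE); exists i0.
by move=> t /(singular_values_gram _ Uu s0 GE)[i ->]; exact: sj.
Qed.

(** By the Penrose identities, [P = A *m pinv A] is idempotent and Hermitian, and Pythagoras
    applies: the squared norms of [y] and [P *m y] differ by that of [y - P *m y]. *)
Lemma l2norm_pinv_proj m n (A : 'M[R[i]]_(m, n)) y :
  l2norm (A *m (pinv A *m y)) <= l2norm y.
Proof.
have /and4P[/eqP AXA _ /eqP Ph _] := pinvP A.
rewrite mulmxA; set P := A *m pinv A in AXA Ph *.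
have PP : P *m P = P by rewrite {2}/P mulmxA AXA.
clearbody P.
rewrite -(@ler_pXn2r _ 2) ?nnegrE ?l2norm_ge0 // -lecR !l2norm_sqrE.
rewrite -subr_ge0.
suff <- : (l2norm (y - P *m y) ^+ 2)%:C =
    (y ^t* *m y) 0 0 - ((P *m y) ^t* *m (P *m y)) 0 0.
  by rewrite ler0c sqr_ge0.
have -> : y - P *m y = (1%:M - P) *m y by rewrite mulmxBl mul1mx.
have Qh : (1%:M - P) ^t* = 1%:M - P.
  by rewrite linearB /= map_mxB Ph trmx1 map_mx1.
rewrite l2norm_sqrE !ctmxM Ph Qh -!mulmxA (mulmxA P P) PP (mulmxA (1%:M - P)).
rewrite mulmxBl mul1mx mulmxBr mulmx1 PP subrr subr0 mulmxBl mul1mx mulmxBr.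
by rewrite !mxE.
Qed.

End EuclideanNorm.

Lemma colspanP (F : fieldType) m n (A : 'M[F]_(m, n)) x :
  x \in colspan A -> exists c : 'cV[F]_n, x = A *m c.
Proof.
rewrite /colspan; set s := [seq _ | _ : _] => xs.
rewrite (coord_span (X := in_tuple s) xs).
elim/big_ind: _ => [|_ _ [c ->] [d ->]|i _].
- by exists 0; rewrite mulmx0.
- by exists (c + d); rewrite mulmxDr.
- have /mapP[j _ ->] : (in_tuple s)`_i \in s by rewrite mem_nth.
  by exists (coord (in_tuple s) i x *: delta_mx j 0); rewrite -scalemxAr colE.
Qed.

Theorem theorem5p3 (R : realType) (n : nat)
    (e : rel 'I_n) (w : 'I_n -> 'I_n -> R)
    (V : 'M[R[i]]_n) (lambda : 'rV[R[i]]_n)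
    (Omega M : {set 'I_n}) (x : 'cV[R[i]]_n) (eta : 'cV[R[i]]_#|M|) :
  V \in unitmx ->
  complexify (laplacian e w) = V *m diag_mx lambda *m invmx V ->
  (1 <= #|Omega|)%N ->
  let V_Omega := col_restrict V Omega in
  let P_M := restriction R[i] M in
  let B := P_M *m V_Omega in
  \rank B = #|Omega| ->
  let gamma := sigma_min B in
  x \in colspan V_Omega ->
  let y := P_M *m x + eta in
  let x_hat := V_Omega *m (pinv B *m y) in
  0 < gamma /\
  l2norm (x_hat - x) <= spectral_norm V_Omega * (l2norm eta / gamma).
Proof.
move=> _ _ K0 V_Omega P_M B rB gamma /colspanP[c xE] y x_hat.
have g0 : 0 < gamma by exact: sigma_min_gt0.
split=> //.
(* Noiseless samples return the coefficients [c] exactly, leaving only the noise term. *)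
have -> : x_hat - x = V_Omega *m (pinv B *m eta).
  rewrite /x_hat /y xE (mulmxA P_M) -/B (mulmxDr (pinv B)) (mulmxA (pinv B)).
  rewrite pinv_mulmx_full // mul1mx.
  by rewrite mulmxDr addrC addKr.
apply: le_trans (l2norm_mulmx_le _ _) _; apply: ler_wpM2l.
  exact: spectral_norm_ge0.
rewrite ler_pdivlMr // mulrC.
exact: le_trans (sigma_min_l2norm _ _) (l2norm_pinv_proj _ _).
Qed.
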